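(* Let $D=\mathbb{Q}\mathbb{U}_1$ be the rational Urysohn sphere and let $$K(D)=\{f\in[0,1]^D:\ |f(x)-f(y)|\le d(x,y)\le f(x)+f(y)\ \text{for all }x,y\in D\}.$$ The two constant functions $\mathbf{1}(x)=1$ and $\mathbf{h}(x)=\frac12$ ($x\in D$) are extreme points of $K(D)$.
   Context: The rational Urysohn sphere $\mathbb{Q}\mathbb{U}_1$ is the (unique up to isometry) countable metric space $(D,d)$ with rational distances, of diameter one, with the following extension property: for every finite $F\subset D$ and every map $p:F\to\mathbb{Q}\cap[0,1]$ with $|p(x)-p(y)|\le d(x,y)\le p(x)+p(y)$ for all $x,y\in F$, there is $z\in D$ with $d(z,x)=p(x)$ for all $x\in F$. $K(D)$ is a compact convex subset of $[0,1]^D$. *)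

(* Defs.v *)
From HB Require Import structures.
From mathcomp Require Import all_boot all_order all_algebra.
From mathcomp Require Import all_classical all_reals all_analysis.

Set Implicit Arguments.
Unset Strict Implicit.
Unset Printing Implicit Defensive.

Import Order.TTheory GRing.Theory Num.Theory.
Import numFieldNormedType.Exports.

Local Open Scope classical_set_scope.
Local Open Scope ring_scope.

Definition diameter (R : realType) (D : metricType R) : \bar R :=
  ereal_sup [set (mdist x y)%:E | x in [set: D] & y in [set: D]].

(* The values of [p] outside [F] are irrelevant: total functions stand for
   maps p : F -> Q `&` [0, 1]. *)
Definition extension_property (R : realType) (D : metricType R) : Prop :=
  forall (F : set D) (p : D -> rat), finite_set F ->
    (forall x, F x -> 0 <= p x <= 1) ->
    (forall x y, F x -> F y ->
       `|ratr (p x) - ratr (p y)| <= mdist x y <= ratr (p x) + ratr (p y)) ->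
  exists z : D, forall x, F x -> mdist z x = ratr (p x).

(* A predicate characterizing the rational Urysohn sphere up to isometry. *)
Definition rational_urysohn_sphere (R : realType) (D : metricType R) : Prop :=
  [/\ countable [set: D],
      forall x y : D, exists q : rat, mdist x y = ratr q,
      diameter D = 1%:E
    & extension_property D].

Definition katetov_set (R : realType) (D : metricType R) : set (D -> R) :=
  [set f | (forall x, 0 <= f x <= 1) /\
           (forall x y, `|f x - f y| <= mdist x y <= f x + f y)].
Arguments katetov_set {R} D _.

Definition extreme_point (R : realType) (E : lmodType R) (A : set E) (e : E) :
    Prop :=
  A e /\ forall (u v : E) (t : R), A u -> A v -> 0 < t < 1 ->
    e = t *: u + (1 - t) *: v -> u = e /\ v = e.

(* Main.v *)
Require Import Defs.
From HB Require Import structures.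
From mathcomp Require Import all_boot all_order all_algebra.
From mathcomp Require Import all_classical all_reals all_analysis.
From mathcomp Require Import lra.

Set Implicit Arguments.
Unset Strict Implicit.
Unset Printing Implicit Defensive.

Import Order.TTheory GRing.Theory Num.Theory.
Import numFieldNormedType.Exports.

Local Open Scope classical_set_scope.
Local Open Scope ring_scope.

(** At a point where the value [1] is the maximum allowed, a convex combination
    equal to [1] is trivial.  For the constant [1/2], every point [x] lies in an
    equilateral triangle [x, y, z] of side [1]; on each side the constraint
    [1 <= f x + f y] is tight for the constant [1/2], hence tight for both terms
    of a convex combination, and the three equations [f x + f y = f y + f z =
    f x + f z = 1] force [f x = 1/2]. *)

Lemma mdist_le_diameter (R : realType) (D : metricType R) (x y : D) :
  ((mdist x y)%:E <= diameter D)%E.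
Proof. by apply: ereal_sup_ubound; exists x => //; exists y. Qed.

(** The constant [1] is an admissible prescription because [mdist x y <= 1 <= 1 + 1]. *)
Lemma extension_property_far (R : realType) (D : metricType R) (F : set D) :
  (forall x y : D, mdist x y <= 1) -> extension_property D -> finite_set F ->
  exists z : D, forall x, F x -> mdist z x = 1.
Proof.
move=> d_le1 extD finF.
have [|x y _ _|z Fz] := extD F (fun=> 1) finF.
- by move=> x _; rewrite ler01 lexx.
- rewrite rmorph1 subrr normr0 mdist_ge0 /=.
  by rewrite (le_trans (d_le1 x y))// lerDl.
- by exists z => x /Fz ->; rewrite rmorph1.
Qed.

Lemma cst_katetov (R : realType) (D : metricType R) (c : R) :
  (forall x y : D, mdist x y <= 1) -> 1 / 2 <= c <= 1 ->
  katetov_set D (fun=> c).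
Proof.
move=> d_le1 /andP[c_ge c_le]; split => [x|x y]; first by lra.
by rewrite subrr normr0 mdist_ge0 (le_trans (d_le1 x y))//=; lra.
Qed.

(** Both weights are positive, so an excess over [c] in one term would need a deficit in the
    other. *)
Lemma conv_tight_ge (R : realFieldType) (a b c t : R) : 0 < t < 1 ->
  c <= a -> c <= b -> c = t * a + (1 - t) * b -> a = c /\ b = c.
Proof. by move=> /andP[t0 t1] ca cb e; split; nra. Qed.

Lemma conv_tight_le (R : realFieldType) (a b c t : R) : 0 < t < 1 ->
  a <= c -> b <= c -> c = t * a + (1 - t) * b -> a = c /\ b = c.
Proof. by move=> /andP[t0 t1] ca cb e; split; nra. Qed.

Theorem proposition6p2 (R : realType) (D : metricType R)
    (hD : rational_urysohn_sphere D) :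
  extreme_point (katetov_set D) (fun _ : D => 1 : R) /\
  extreme_point (katetov_set D) (fun _ : D => 1 / 2 : R).
Proof.
have [_ _ diamD extD] := hD.
have d_le1 (x y : D) : mdist x y <= 1.
  by rewrite -lee_fin -diamD mdist_le_diameter.
split; split.
- by apply: cst_katetov => //; lra.
- move=> u v t [u01 _] [v01 _] t01 uv.
  have uv1 x : u x = 1 /\ v x = 1.
    have /andP[_ ux] := u01 x; have /andP[_ vx] := v01 x.
    exact: (conv_tight_le t01 ux vx (congr1 (@^~ x) uv)).
  by split; apply/funext => x; have [] := uv1 x.
- by apply: cst_katetov => //; lra.
- move=> u v t [_ uK] [_ vK] t01 uv.
  have tight x y : mdist x y = 1 -> u x + u y = 1 /\ v x + v y = 1.
    move=> xy1; have := uK x y; have := vK x y; rewrite xy1.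
    move=> /andP[_ vxy] /andP[_ uxy]; apply: (conv_tight_ge t01) => //.
    (* Adding the equations at [x] and [y] writes [1] as the convex combination of [u x + u y] and
       [v x + v y]. *)
    have uvx : 1 / 2 = t * u x + (1 - t) * v x := congr1 (@^~ x) uv.
    have uvy : 1 / 2 = t * u y + (1 - t) * v y := congr1 (@^~ y) uv.
    lra.
  have uvh x : u x = 1 / 2 /\ v x = 1 / 2.
    (* The triangle is built in two extensions: [y] at distance [1] from [x], then [z] at distance
       [1] from both. *)
    have [y /(_ x erefl)/tight[uyx vyx]] :=
      extension_property_far d_le1 extD (finite_set1 x).
    have [z zd] := extension_property_far d_le1 extD (finite_set2 x y).
    have [uzx vzx] := tight _ _ (zd x (or_introl erefl)).
    have [uzy vzy] := tight _ _ (zd y (or_intror erefl)).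
    by split; lra.
  by split; apply/funext => x; have [] := uvh x.
Qed.
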